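(* Let $\mathcal{R}_i:\mathbb{X}\to\mathbb{Y}^i$ ($i=1,\dots,m$) be local randomizers, let $\boldsymbol{p}=(p_1,\dots,p_m)$ be a probability vector, and let $\mathcal{R}^{\parallel,\boldsymbol{p}}_{[1:m]}$ be the parallel composition, which on input $x\in\mathbb{X}$ outputs $(i,\mathcal{R}_i(x))$ with probability $p_i$, $i=1,\dots,m$. Let $x_1^0,x_1^1\in\mathbb{X}$. Then the weighted combination, with weights $p_i$, of the primary optimal decompositions of the $\mathcal{R}_i$ with respect to $(x_1^0,x_1^1)$ is an optimal decomposition of $\mathcal{R}^{\parallel,\boldsymbol{p}}_{[1:m]}$ with respect to $(x_1^0,x_1^1)$; and the same holds for the weighted combination, with weights $p_i$, of the simplified optimal decompositions of the $\mathcal{R}_i$.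
   Context: All $\mathbb{Y}^i$ are finite. A local randomizer $\mathcal{R}:\mathbb{X}\to\mathbb{Y}$ is a randomized map; $\mathcal{R}(x)$ is its output distribution on input $x$ and $\mathcal{R}(x)(y)$ the probability of $y$. General clone decomposition of $\mathcal{R}:\mathbb{X}\to\mathbb{Y}$ with respect to $(x_1^0,x_1^1)\in\mathbb{X}^2$: a finite family of probability distributions $(Q^j)_{j\in J}$ on $\mathbb{Y}$, non-negative coefficients $a_j,b_j,c_j$ ($j\in J$) and $\beta$ with $\sum_j a_j=\sum_j b_j=\beta+\sum_j c_j=1$, and for each $x\in\mathbb{X}$ a left-over probability distribution $\mathrm{LO}(x)$ (arbitrary if $\beta=0$), such that $\mathcal{R}(x_1^0)=\sum_j a_jQ^j$, $\mathcal{R}(x_1^1)=\sum_j b_jQ^j$, and $\mathcal{R}(x)=\sum_j c_jQ^j+\beta\,\mathrm{LO}(x)$ for all $x\in\mathbb{X}$. Reduction pair: let $A_0,A_1,A_2$ be distributions on $J\cup\{\bot\}$ with $\Pr[A_0=j]=a_j$, $\Pr[A_1=j]=b_j$, $\Pr[A_2=j]=c_j$ for $j\in J$, $\Pr[A_0=\bot]=\Pr[A_1=\bot]=0$, $\Pr[A_2=\bot]=\beta$. For $a\in\{0,1\}$, $P_a^{\mathsf{GC}}$ is the distribution of the histogram of $n$ independent samples, one from $A_a$ and $n-1$ from $A_2$, where $n\geq 1$ is the number of users. Privacy blanket reduction pair: $\gamma=\sum_y\inf_x\mathcal{R}(x)(y)$, $\omega(y)=\inf_x\mathcal{R}(x)(y)/\gamma$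 ($\omega$ arbitrary if $\gamma=0$). For $a\in\{0,1\}$, $P_a^{\mathsf{B}}$ is the distribution of $(M,Y^a_M)$ with $M\sim\mathrm{Bin}(n-1,\gamma)$ and, given $M$, $Y^a_M$ the multiset consisting of one sample from $\mathcal{R}(x_1^a)$ and $M$ independent samples from $\omega$. Optimal decomposition: a general clone decomposition equivalent to the privacy blanket framework, i.e. for every $n\ge1$ there are (possibly randomized) functions $f,g$ with $f(P_a^{\mathsf{B}})=P_a^{\mathsf{GC}}$ and $g(P_a^{\mathsf{GC}})=P_a^{\mathsf{B}}$ in distribution for both $a=0,1$. Primary optimal decomposition of $\mathcal{R}$ with respect to $(x_1^0,x_1^1)$: $J=\mathbb{Y}$, $Q^y=\mathbb{1}_y$ (point mass), $a_y=\mathcal{R}(x_1^0)(y)$, $b_y=\mathcal{R}(x_1^1)(y)$, $c_y=\inf_x\mathcal{R}(x)(y)$, $\beta=1-\sum_y c_y$. Simplified optimal decomposition (for $\mathcal{R}$ with $\inf_x\mathcal{R}(x)(y)>0$ for all $y$; this is assumed of every $\mathcal{R}_i$ in the simplified case): with $S_{r_0,r_1}=\{y:\mathcal{R}(x_1^0)(y)=r_0\inf_x\mathcal{R}(x)(y),\ \mathcal{R}(x_1^1)(y)=r_1\inf_x\mathcal{R}(x)(y)\}$, $J$ is the set of $(r_0,r_1)$ with $S_{r_0,r_1}\ne\emptyset$, $a_{r_0,r_1}=\sum_{y\in S_{r_0,r_1}}\mathcal{R}(x_1^0)(y)$, $b_{r_0,r_1}=\sum_{y\in S_{r_0,r_1}}\mathcal{R}(x_1^1)(y)$,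 $c_{r_0,r_1}=\sum_{y\in S_{r_0,r_1}}\inf_x\mathcal{R}(x)(y)$, $Q^{r_0,r_1}(y)=\mathcal{R}(x_1^0)(y)/a_{r_0,r_1}$ on $S_{r_0,r_1}$ and $0$ elsewhere, $\beta=1-\sum c_{r_0,r_1}$. Weighted combination: given decompositions of $\mathcal{R}_i$ with data $(J_i,Q^{(i),j},a^{(i)}_j,b^{(i)}_j,c^{(i)}_j,\beta_i,\mathrm{LO}_i)$, the weighted combination has components indexed by pairs $(i,j)$ with $1\le i\le m$, $j\in J_i$; the component distribution is $Q^{(i),j}$ placed on $\{i\}\times\mathbb{Y}^i$, the coefficients are $p_ia^{(i)}_j$, $p_ib^{(i)}_j$, $p_ic^{(i)}_j$, and the left-over terms are merged into a single left-over part $\beta\,\mathrm{LO}(x)=\sum_i p_i\beta_i\mathrm{LO}_i(x)$ with $\mathrm{LO}_i(x)$ placed on $\{i\}\times\mathbb{Y}^i$ and $\beta=\sum_i p_i\beta_i$. *)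

(* Defs.v *)
From HB Require Import structures.
From mathcomp Require Import all_boot all_order all_algebra.
From mathcomp Require Import boolp classical_sets reals.
From mathcomp Require Import binomial_distribution.

Set Implicit Arguments.
Unset Strict Implicit.
Unset Printing Implicit Defensive.

Import Order.TTheory GRing.Theory Num.Theory.

Local Open Scope ring_scope.

Section FiniteDistributions.
Context {R : realType}.

Definition is_dist (T : finType) (p : T -> R) : Prop :=
  (forall t, 0 <= p t) /\ \sum_t p t = 1.

(* A randomized function from S to T maps s to a distribution on T;
   [push k p] is the law of its output when the input has law p. *)
Definition is_kernel (S T : finType) (k : S -> T -> R) : Prop :=
  forall s, is_dist (k s).

Definition push (S T : finType) (k : S -> T -> R) (p : S -> R) : T -> R :=
  fun t => \sum_s p s * k s t.

(* Histograms (equivalently, multisets) of at most n elements of T are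
   represented by their multiplicity functions, bounded by n; [inord] does not
   truncate as long as size s <= n. *)
Definition histogram (n : nat) (T : finType) (s : seq T) : {ffun T -> 'I_n.+1} :=
  [ffun t => inord (count_mem t s)].

(* The law of the histogram of k + 1 independent samples: one from p and k from
   q. It is meant for k < n. *)
Definition histogram_law (n : nat) (T : finType) (p q : T -> R) (k : nat)
    (h : {ffun T -> 'I_n.+1}) : R :=
  \sum_(z : T) \sum_(s : k.-tuple T | histogram n (z :: s) == h)
    p z * \prod_(t <- s) q t.

End FiniteDistributions.

(* A local randomizer is a map r : X -> Y -> R, where r x y is the probability
   of output y on input x. *)
Definition local_randomizer (R : realType) (X : Type) (Y : finType)
    (r : X -> Y -> R) : Prop :=
  forall x, is_dist (r x).

Section Decompositions.
Context {R : realType} {X : Type} {Y : finType}.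
Implicit Types (r : X -> Y -> R) (x : X).

Definition inf_prob r (y : Y) : R := inf (range (fun x => r x y))%classic.

Record decomposition := Decomposition {
  component : finType;
  comp_dist : component -> Y -> R;
  coef_a : component -> R;
  coef_b : component -> R;
  coef_c : component -> R;
  coef_beta : R;
  left_over : X -> Y -> R
}.

Record clone_decomposition r x0 x1 (D : decomposition) : Prop := {
  comp_dist_is_dist : forall j, is_dist (@comp_dist D j);
  coef_a_ge0 : forall j, 0 <= @coef_a D j;
  coef_b_ge0 : forall j, 0 <= @coef_b D j;
  coef_c_ge0 : forall j, 0 <= @coef_c D j;
  coef_beta_ge0 : 0 <= coef_beta D;
  coef_a_sum : \sum_j @coef_a D j = 1;
  coef_b_sum : \sum_j @coef_b D j = 1;
  coef_c_sum : coef_beta D + \sum_j @coef_c D j = 1;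
  left_over_is_dist : forall x, is_dist (left_over D x);
  decomp_x0 : forall y, r x0 y = \sum_j coef_a j * @comp_dist D j y;
  decomp_x1 : forall y, r x1 y = \sum_j coef_b j * @comp_dist D j y;
  decomp_x : forall x y,
    r x y = \sum_j coef_c j * @comp_dist D j y + coef_beta D * left_over D x y
}.

(* The index set J with the extra point bottom is [option J], bottom = None. *)
Definition A_first (D : decomposition) (a : bool) (j : option (component D)) : R :=
  if j is Some j then (if a then coef_b j else coef_a j) else 0.

Definition A_other (D : decomposition) (j : option (component D)) : R :=
  if j is Some j then coef_c j else coef_beta D.

Definition P_GC (D : decomposition) (n : nat) (a : bool) :
    {ffun option (component D) -> 'I_n.+1} -> R :=
  histogram_law (A_first a) (@A_other D) n.-1.

Definition blanket_mass r : R := \sum_y inf_prob r y.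

Definition blanket_dist r (omega : Y -> R) : Prop :=
  is_dist omega /\
  (blanket_mass r != 0 -> forall y, omega y = inf_prob r y / blanket_mass r).

(* Since M is at most n - 1, the pair (M, Y_M) lives in
   'I_n * {ffun Y -> 'I_n.+1} for n >= 1. *)
Definition P_B r x0 x1 (omega : Y -> R) (n : nat) (a : bool)
    (o : 'I_n * {ffun Y -> 'I_n.+1}) : R :=
  binomial_pmf n.-1 (blanket_mass r) o.1
  * histogram_law (r (if a then x1 else x0)) omega o.1 o.2.

Definition equivalent_to_blanket r x0 x1 (D : decomposition) : Prop :=
  forall n : nat, (0 < n)%N ->
  forall omega : Y -> R, blanket_dist r omega ->
  exists (f : 'I_n * {ffun Y -> 'I_n.+1} ->
              {ffun option (component D) -> 'I_n.+1} -> R)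
         (g : {ffun option (component D) -> 'I_n.+1} ->
              'I_n * {ffun Y -> 'I_n.+1} -> R),
    [/\ is_kernel f, is_kernel g &
        forall a : bool,
          push f (P_B r x0 x1 omega a) =1 @P_GC D n a /\
          push g (@P_GC D n a) =1 P_B r x0 x1 omega a].

Definition optimal_decomposition r x0 x1 (D : decomposition) : Prop :=
  clone_decomposition r x0 x1 D /\ equivalent_to_blanket r x0 x1 D.

(* The left-over part is determined by r x = sum_j c_j Q_j + beta LO(x) when
   beta != 0, and is the arbitrary family dflt when beta = 0. *)
Definition left_over_of r (J : finType) (Q : J -> Y -> R) (c : J -> R)
    (beta : R) (dflt : X -> Y -> R) : X -> Y -> R :=
  fun x y => if beta == 0 then dflt x y
             else (r x y - \sum_j c j * Q j y) / beta.

Definition primary_decomposition r x0 x1 (dflt : X -> Y -> R) : decomposition :=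
  let Q := fun j y : Y => (y == j)%:R in
  let c := inf_prob r in
  let beta := 1 - \sum_y c y in
  {| component := Y;
     comp_dist := Q;
     coef_a := r x0;
     coef_b := r x1;
     coef_c := c;
     coef_beta := beta;
     left_over := left_over_of r Q c beta dflt |}.

Definition ratio_class r x0 x1 (w : R * R) : {set Y} :=
  [set y | (r x0 y == w.1 * inf_prob r y) && (r x1 y == w.2 * inf_prob r y)].

(* When all infima are positive, the pairs w with nonempty [ratio_class] are
   exactly those in the following list (lemma [ratiosP]); [seq_sub] turns it
   into a finite type, without repetitions. *)
Definition ratios r x0 x1 : seq (R * R) :=
  [seq (r x0 y / inf_prob r y, r x1 y / inf_prob r y) | y : Y].

Lemma ratiosP r x0 x1 (w : R * R) :
  (forall y, 0 < inf_prob r y) ->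
  (w \in ratios r x0 x1) = (ratio_class r x0 x1 w != finset.set0).
Proof.
move=> inf_gt0; have inf_neq0 y : inf_prob r y != 0 by rewrite gt_eqF.
apply/mapP/set0Pn => [[y _ ->]|[y]].
  by exists y; rewrite inE /= !divfK ?eqxx.
rewrite inE => /andP[/eqP e0 /eqP e1]; exists y; first by rewrite mem_enum.
by rewrite e0 e1 !mulfK //; case: w {e0 e1}.
Qed.

Definition simplified_decomposition r x0 x1 (dflt : X -> Y -> R) :
    decomposition :=
  let S := fun j : seq_sub (ratios r x0 x1) => ratio_class r x0 x1 (ssval j) in
  let a := fun j => \sum_(y in S j) r x0 y in
  let b := fun j => \sum_(y in S j) r x1 y in
  let c := fun j => \sum_(y in S j) inf_prob r y in
  let Q := fun j y => if y \in S j then r x0 y / a j else 0 in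
  let beta := 1 - \sum_j c j in
  {| component := seq_sub (ratios r x0 x1);
     comp_dist := Q;
     coef_a := a;
     coef_b := b;
     coef_c := c;
     coef_beta := beta;
     left_over := left_over_of r Q c beta dflt |}.

End Decompositions.

Arguments decomposition R X Y : clear implicits.

Section Parallel.
Context {R : realType} {X : Type} {m : nat} {Y : 'I_m -> finType}.

Definition parallel (p : 'I_m -> R) (r : forall i, X -> Y i -> R) :
    X -> {i : 'I_m & Y i} -> R :=
  fun x u => p (tag u) * r (tag u) x (tagged u).

(* [untag 0 q] is q : Y i -> R placed on {i} x Y i and extended by 0. The merged
   left-over part is the arbitrary family dflt when the total beta is 0. *)
Definition weighted_combination (p : 'I_m -> R)
    (D : forall i, decomposition R X (Y i))
    (dflt : X -> {i : 'I_m & Y i} -> R) :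
    decomposition R X {i : 'I_m & Y i} :=
  let beta := \sum_i p i * coef_beta (D i) in
  {| component := {i : 'I_m & component (D i)};
     comp_dist := fun j u => untag 0 (comp_dist (tagged j)) u;
     coef_a := fun j => p (tag j) * coef_a (tagged j);
     coef_b := fun j => p (tag j) * coef_b (tagged j);
     coef_c := fun j => p (tag j) * coef_c (tagged j);
     coef_beta := beta;
     left_over := fun x u =>
       if beta == 0 then dflt x u
       else (\sum_i p i * coef_beta (D i) * untag 0 (left_over (D i) x) u)
            / beta |}.

End Parallel.

(* Main.v *)
(* A decomposition D is optimal as soon as it is related to the randomizer by
   kernels acting on single samples: a kernel k on outputs that turns r x0, r x1
   and the infimum c = inf_x r x into the coefficients a, b, c of D, while the
   component distributions of D turn c back into inf_x r x (they turn a and b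
   back by definition). Applying a kernel independently to each element of a
   multiset carries this over to the privacy blanket laws. Sorting the n - 1
   samples from A_2 by how many of them are bottom shows that adding n - 1 - M
   copies of bottom to a multiset drawn from a blanket law gives the clone law;
   this operation is injective, hence undone by removing the bottoms.
   For the primary decomposition k is the identity, for the simplified one it
   sends an output to its ratio class. The property is stable under weighted
   combinations because inf_x commutes with the weights p_i. *)
Require Import Defs.
From mathcomp Require Import all_boot all_order all_algebra.
From mathcomp Require Import boolp classical_sets reals.
From mathcomp Require Import binomial_distribution.

Set Implicit Arguments.
Unset Strict Implicit.
Unset Printing Implicit Defensive.

Import Order.TTheory GRing.Theory Num.Theory.

Local Open Scope ring_scope.

(** * Expectations over independent samples *)

Section IndependentSamples.
Context {R : realType}.

(* The integral of F against the product of the weights ws, i.e. the expectation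
   of F over independent samples when every entry of ws is a distribution. *)
Fixpoint indep_sum (T : finType) (ws : seq (T -> R)) (F : seq T -> R) : R :=
  if ws is w :: ws' then \sum_t w t * indep_sum ws' (fun s => F (t :: s))
  else F [::].

Section OneType.
Context {T : finType}.
Implicit Types (w : T -> R) (ws : seq (T -> R)) (F G : seq T -> R).

Lemma eq_indep_sum ws F G :
  (forall s, size s = size ws -> F s = G s) -> indep_sum ws F = indep_sum ws G.
Proof.
elim: ws F G => [|w ws IH] F G eqFG /=; first exact: eqFG.
by apply: eq_bigr => t _; congr (_ * _); apply: IH => s ss; rewrite eqFG //= ss.
Qed.

Lemma indep_sum_big (I : finType) (P : pred I) ws (F : I -> seq T -> R) :
  indep_sum ws (fun s => \sum_(i | P i) F i s) = \sum_(i | P i) indep_sum ws (F i).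
Proof.
elim: ws F => [|w ws IH] F //=; rewrite exchange_big /=.
by apply: eq_bigr => t _; rewrite IH mulr_sumr.
Qed.

Lemma indep_sumZ a ws F :
  indep_sum ws (fun s => a * F s) = a * indep_sum ws F.
Proof.
elim: ws F => [|w ws IH] F //=; rewrite mulr_sumr.
by apply: eq_bigr => t _; rewrite IH mulrCA.
Qed.

Lemma indep_sum_cat ws vs F :
  indep_sum (ws ++ vs) F =
  indep_sum ws (fun s => indep_sum vs (fun u => F (s ++ u))).
Proof. by elim: ws F => [|w ws IH] F //=; apply: eq_bigr => t _; rewrite IH. Qed.

Lemma indep_sum_ge0 ws F :
  (forall i t, 0 <= nth (fun=> 0) ws i t) -> (forall s, 0 <= F s) ->
  0 <= indep_sum ws F.
Proof.
elim: ws F => [|w ws IH] F //= w_ge0 F_ge0.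
apply: sumr_ge0 => t _; apply: mulr_ge0; first exact: (w_ge0 0).
by apply: IH => // i; apply: (w_ge0 i.+1).
Qed.

(** Homogeneity of degree k. It moves the factor gamma^M of the binomial weight into the M blanket
    samples. *)
Lemma indep_sum_scale k w a F :
  indep_sum (nseq k (fun t => a * w t)) F = a ^+ k * indep_sum (nseq k w) F.
Proof.
elim: k F => [|k IH] F /=; first by rewrite mul1r.
by rewrite mulr_sumr; apply: eq_bigr => t _; rewrite IH exprS mulrACA.
Qed.

(** Bridge from the sums over tuples in [histogram_law] to the recursive form, on which the
    inductions run. *)
Lemma sum_tuple_prod k w F :
  \sum_(s : k.-tuple T) F s * \prod_(t <- s) w t = indep_sum (nseq k w) F.
Proof.
elim: k F => [|k IH] F /=.
  rewrite (big_pred1 [tuple of [::]]) ?big_nil ?mulr1 // => s.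
  by apply/esym/eqP; exact: tuple0.
rewrite (reindex (fun ts : T * k.-tuple T => [tuple of ts.1 :: ts.2])) /=;
  last first.
  exists (fun s : k.+1.-tuple T => (thead s, [tuple of behead s])).
    by case=> t s _ /=; congr pair; apply: val_inj.
  by move=> s _; rewrite /= -tuple_eta.
rewrite -(pair_bigA _ (fun t (s : k.-tuple T) =>
  F (t :: s) * \prod_(u <- t :: s) w u)) /=.
apply: eq_bigr => t _; rewrite -IH mulr_sumr; apply: eq_bigr => s _.
by rewrite big_cons mulrCA.
Qed.

End OneType.

Lemma exchange_indep_sum (S T : finType) (ws : seq (S -> R)) (vs : seq (T -> R)) F :
  indep_sum ws (fun s => indep_sum vs (fun u => F s u)) =
  indep_sum vs (fun u => indep_sum ws (fun s => F s u)).
Proof.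
elim: ws F => [|w ws IH] F //=; rewrite indep_sum_big.
by apply: eq_bigr => t _; rewrite indep_sumZ -IH.
Qed.

(** By Fubini, two neighbouring blocks of integrations can be exchanged, and such block exchanges
    generate all permutations. *)
Lemma perm_indep_sum (S T : finType) (k : S -> T -> R) (F : seq T -> R)
    (s s' : seq S) :
  (forall u v, perm_eq u v -> F u = F v) -> perm_eq s s' ->
  indep_sum (map k s) F = indep_sum (map k s') F.
Proof.
move=> permF; apply: (@catCA_perm_subst _ _ (fun s => indep_sum (map k s) F)).
move=> s1 s2 s3; rewrite !map_cat !indep_sum_cat exchange_indep_sum indep_sum_cat.
apply: eq_indep_sum => u _; rewrite indep_sum_cat exchange_indep_sum.
apply: eq_indep_sum => v _; apply: eq_indep_sum => x _; apply: permF.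
by rewrite perm_catCA.
Qed.

Lemma indep_sum_kernel (S T : finType) (k : S -> T -> R) (s : seq S) :
  is_kernel k -> indep_sum (map k s) (fun=> 1) = 1.
Proof.
move=> kk; elim: s => [|x s IH] //=; rewrite IH.
by under eq_bigr do rewrite mulr1; apply: (kk x).2.
Qed.

(** Tower rule: sampling s and then applying k to each entry independently gives independent samples
    from the pushed laws. *)
Lemma indep_sum_push (S T : finType) (k : S -> T -> R) (ws : seq (S -> R)) F :
  indep_sum ws (fun s => indep_sum (map k s) F) = indep_sum (map (push k) ws) F.
Proof.
elim: ws F => [|w ws IH] F //=.
under eq_bigr do rewrite indep_sum_big mulr_sumr.
rewrite exchange_big /=; apply: eq_bigr => t _; rewrite mulr_suml.
apply: eq_bigr => x _; rewrite indep_sumZ mulrA; congr (_ * _); exact: IH.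
Qed.

(* Pascal's rule, on the number of None entries. *)
Lemma indep_sum_thinning (T : finType) N (w : option T -> R) (F : seq T -> R) :
  indep_sum (nseq N w) (fun s => F (pmap id s)) =
  \sum_(M < N.+1) 'C(N, M)%:R * w None ^+ (N - M)
                  * indep_sum (nseq M (w \o Some)) F.
Proof.
elim: N F => [|N IH] F /=; first by rewrite big_ord_recl big_ord0 /= !mul1r addr0.
have sum_option (G : option T -> R) : \sum_o G o = G None + \sum_t G (Some t).
  rewrite (bigD1 None) //=; congr (_ + _).
  rewrite (reindex_omap Some id) => [|[]] //=.
  by apply: eq_bigl => t; rewrite eqxx.
rewrite sum_option (IH F).
under [X in _ + X]eq_bigr => t _ do rewrite (IH (fun s => F (t :: s))) mulr_sumr.
rewrite exchange_big /= [RHS]big_ord_recl /= subn0 bin0 mul1r.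
under [X in _ = _ + X]eq_bigr => M _ do
  rewrite /bump /= add1n binS subSS natrD !mulrDl.
(* The summand with ['C(N, M)] is the case of a first entry [Some t]. The head term and the summand
   with ['C(N, M.+1)] together form the case of a first entry [None]. *)
rewrite big_split /= [in RHS]addrA; congr (_ + _); last first.
  apply: eq_bigr => M _; rewrite !mulr_sumr; apply: eq_bigr => t _.
  by rewrite mulrCA.
rewrite [X in _ = _ + X]big_ord_recr /= bin_small // !mul0r addr0.
rewrite mulr_sumr big_ord_recl /= subn0 bin0 mul1r exprS mulrA; congr (_ + _).
apply: eq_bigr => M _; rewrite /bump /= add1n !mulrA; congr (_ * _).
by rewrite [w None * _]mulrC -mulrA -exprS subnSK.
Qed.

End IndependentSamples.

(** * Calculus of kernels *)

Section Kernels.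
Context {R : realType}.

Definition det_kernel (S T : finType) (f : S -> T) : S -> T -> R :=
  fun s t => (f s == t)%:R.

Definition comp_kernel (S T U : finType) (k : S -> T -> R) (l : T -> U -> R) :
    S -> U -> R :=
  fun s => push l (k s).

(** In the application the first coordinate is the number M of blanket samples, which has to survive
    unchanged. *)
Definition snd_kernel (A S T : finType) (k : S -> T -> R) : A * S -> A * T -> R :=
  fun o o' => (o.1 == o'.1)%:R * k o.2 o'.2.

Lemma sum_indicator (T : finType) (t : T) (F : T -> R) :
  \sum_u (t == u)%:R * F u = F t.
Proof.
rewrite (bigD1 t) //= eqxx mul1r big1 ?addr0 // => u /negPf ut.
by rewrite eq_sym ut mul0r.
Qed.

Lemma det_kernel_is_kernel (S T : finType) (f : S -> T) : is_kernel (det_kernel f).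
Proof.
move=> s; split=> [t|]; first exact: ler0n.
by under eq_bigr do rewrite -[det_kernel _ _ _]mulr1; exact: sum_indicator.
Qed.

Lemma sum_push (S T : finType) (k : S -> T -> R) (p : S -> R) :
  is_kernel k -> \sum_t push k p t = \sum_s p s.
Proof.
move=> kk; rewrite exchange_big /=; apply: eq_bigr => s _.
by rewrite -mulr_sumr (kk s).2 mulr1.
Qed.

Lemma comp_kernel_is_kernel (S T U : finType) (k : S -> T -> R) (l : T -> U -> R) :
  is_kernel k -> is_kernel l -> is_kernel (comp_kernel k l).
Proof.
move=> kk kl s; split=> [u|]; last by rewrite sum_push // (kk s).2.
by apply: sumr_ge0 => t _; rewrite mulr_ge0 ?(kk s).1 ?(kl t).1.
Qed.

Lemma push_comp (S T U : finType) (k : S -> T -> R) (l : T -> U -> R) (p : S -> R) :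
  push (comp_kernel k l) p =1 push l (push k p).
Proof.
move=> u; rewrite /push /comp_kernel /push.
under eq_bigr do rewrite mulr_sumr.
rewrite exchange_big; apply: eq_bigr => t _; rewrite mulr_suml.
by apply: eq_bigr => s _; rewrite mulrA.
Qed.

Lemma push_det_comp (S T U : finType) (f : S -> T) (g : T -> U) (p : S -> R) :
  push (det_kernel g) (push (det_kernel f) p) =1 push (det_kernel (g \o f)) p.
Proof.
move=> u; rewrite -push_comp; apply: eq_bigr => s _.
by congr (_ * _); apply: sum_indicator.
Qed.

Lemma push_det_cancel (S T : finType) (f : S -> T) (g : T -> S) (p : S -> R) :
  cancel f g -> push (det_kernel g) (push (det_kernel f) p) =1 p.
Proof.
move=> fK s; rewrite push_det_comp /push.
under eq_bigr => u _ do rewrite /det_kernel /= fK eq_sym mulrC.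
exact: sum_indicator.
Qed.

Lemma snd_kernel_is_kernel (A S T : finType) (k : S -> T -> R) :
  is_kernel k -> is_kernel (@snd_kernel A S T k).
Proof.
move=> kk [a s]; split=> [[b t]|]; first by rewrite mulr_ge0 ?ler0n ?(kk s).1.
rewrite -(pair_bigA _ (fun b t => (a == b)%:R * k s t)) /=.
by under eq_bigr do rewrite -mulr_sumr (kk s).2; exact: sum_indicator.
Qed.

Lemma push_snd (A S T : finType) (k : S -> T -> R) (p : A * S -> R) a t :
  push (snd_kernel k) p (a, t) = push k (fun s => p (a, s)) t.
Proof.
rewrite /push (eq_bigr (fun o => p (o.1, o.2) * ((o.1 == a)%:R * k o.2 t)));
  last by case.
rewrite -(pair_bigA _ (fun b s => p (b, s) * ((b == a)%:R * k s t))) /=.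
under eq_bigr => b _ do
  (under eq_bigr do rewrite mulrCA; rewrite -mulr_sumr eq_sym).
exact: sum_indicator.
Qed.

Lemma push_scale (S T : finType) (k : S -> T -> R) c (p : S -> R) t :
  push k (fun s => c * p s) t = c * push k p t.
Proof. by rewrite mulr_sumr; apply: eq_bigr => s _; rewrite mulrA. Qed.

End Kernels.

(** * Kernels acting on multisets *)

Section Histograms.
Context {R : realType} (n : nat).

Lemma histogram_lawE (T : finType) (p q : T -> R) k (h : {ffun T -> 'I_n.+1}) :
  histogram_law p q k h =
  indep_sum (p :: nseq k q) (fun s => (histogram n s == h)%:R).
Proof.
rewrite [RHS]/=; apply: eq_bigr => z _; rewrite -sum_tuple_prod mulr_sumr.
rewrite big_mkcond /=.
by apply: eq_bigr => s _; case: eqP => _; rewrite ?mul1r ?mul0r ?mulr0.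
Qed.

Lemma push_histogram (S U : finType) (k : {ffun S -> 'I_n.+1} -> U -> R) ws u :
  push k (fun h => indep_sum ws (fun s => (histogram n s == h)%:R)) u =
  indep_sum ws (fun s => k (histogram n s) u).
Proof.
rewrite /push; under eq_bigr do rewrite mulrC -indep_sumZ.
rewrite -indep_sum_big; apply: eq_indep_sum => s _.
by under eq_bigr do rewrite mulrC; exact: sum_indicator.
Qed.

(** A list with the prescribed multiplicities, on whose entries a kernel can act; its order is
    immaterial by [perm_indep_sum]. *)
Definition hist_seq (S : finType) (h : {ffun S -> 'I_n.+1}) : seq S :=
  flatten [seq nseq (h x) x | x <- enum S].

Lemma count_hist_seq (S : finType) (h : {ffun S -> 'I_n.+1}) x :
  count_mem x (hist_seq h) = h x.
Proof.
rewrite count_flatten -map_comp sumnE big_map big_enum (bigD1 x) //=.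
rewrite count_nseq /= eqxx mul1n big1 ?addn0 // => y /negPf xy.
by rewrite count_nseq /= xy.
Qed.

Lemma hist_seqK (S : finType) (s : seq S) :
  (size s <= n)%N -> perm_eq (hist_seq (histogram n s)) s.
Proof.
move=> sn; apply/allP => x _; rewrite /= count_hist_seq ffunE inordK // ltnS.
exact: leq_trans (count_size _ _) sn.
Qed.

(** Each element of the multiset is resampled through k independently. If h has more than n
    elements, [inord] may truncate the new counts, but the result is still a distribution. *)
Definition hist_kernel (S T : finType) (k : S -> T -> R) :
    {ffun S -> 'I_n.+1} -> {ffun T -> 'I_n.+1} -> R :=
  fun h g => indep_sum (map k (hist_seq h)) (fun s => (histogram n s == g)%:R).

Lemma hist_kernel_is_kernel (S T : finType) (k : S -> T -> R) :
  is_kernel k -> is_kernel (hist_kernel k).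
Proof.
move=> kk h; split=> [g|].
  apply: indep_sum_ge0 => [i t|s]; last exact: ler0n.
  have [ih|ih] := ltnP i (size (hist_seq h)); last by rewrite nth_default ?size_map.
  case: (hist_seq h) ih => // x s ih.
  by rewrite (nth_map x) ?(kk _).1.
rewrite -indep_sum_big -[RHS](indep_sum_kernel (hist_seq h) kk).
apply: eq_indep_sum => s _.
by under eq_bigr do rewrite -[_%:R]mulr1; exact: sum_indicator.
Qed.

Lemma push_histogram_law (S T : finType) (k : S -> T -> R) p q N :
  (N < n)%N ->
  push (hist_kernel k) (histogram_law p q N) =1
  histogram_law (push k p) (push k q) N.
Proof.
move=> Nn g; rewrite histogram_lawE -map_nseq -map_cons -indep_sum_push.
rewrite -[RHS](eq_indep_sum (F := fun s => hist_kernel k (histogram n s) g)).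
  by rewrite -push_histogram; apply: eq_bigr => h _; rewrite histogram_lawE.
(* The sample has N + 1 <= n entries, so no count is truncated and the list rebuilt from its
   histogram is a permutation of it. *)
move=> s /=; rewrite size_nseq => sN; apply: perm_indep_sum.
  move=> u v /permP uv; congr (_ == _)%:R; apply/ffunP => x.
  by rewrite !ffunE uv.
by apply: hist_seqK; rewrite sN.
Qed.

End Histograms.

(** * Blanket laws and the insertion of bottoms *)

Section BlanketLaw.
Context {R : realType}.

(* The privacy blanket law written with the sub-probability c = gamma * omega in
   place of omega, so that no choice of omega is involved when gamma = 0. *)
Definition blanket_law n (T : finType) (p c : T -> R) (beta : R)
    (o : 'I_n * {ffun T -> 'I_n.+1}) : R :=
  'C(n.-1, o.1)%:R * beta ^+ (n.-1 - o.1) * histogram_law p c o.1 o.2.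

(** The binomial weight depends on M alone, so it factors out; the ordinal bound M < n is the side
    condition of [push_histogram_law]. *)
Lemma push_blanket_law n (S T : finType) (k : S -> T -> R) (p c : S -> R) beta :
  push (snd_kernel (hist_kernel k)) (blanket_law (n := n) p c beta) =1
  blanket_law (push k p) (push k c) beta.
Proof.
case=> M h; rewrite push_snd /blanket_law /= push_scale push_histogram_law //.
Qed.

(** Here n = N + 1. Of the N samples from [A_2], M are not bottom, so N - M bottoms are added; this
    count determines M, whence injectivity. *)
Definition add_bot N (T : finType) (o : 'I_N.+1 * {ffun T -> 'I_N.+2}) :
    {ffun option T -> 'I_N.+2} :=
  [ffun t => if t is Some t then o.2 t else inord (N - o.1)].

Definition drop_bot N (T : finType) (h : {ffun option T -> 'I_N.+2}) :
    'I_N.+1 * {ffun T -> 'I_N.+2} :=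
  (inord (N - h None), [ffun t => h (Some t)]).

Lemma add_botK N (T : finType) : cancel (@add_bot N T) (@drop_bot N T).
Proof.
case=> M h; congr pair; last by apply/ffunP => t; rewrite !ffunE.
have leMN : (M <= N)%N by rewrite -ltnS.
apply: val_inj; rewrite ffunE /= inordK; last first.
  by rewrite inordK ltnS ?leq_subr // leqW // leq_subr.
by rewrite inordK ?subKn // ltnS leqW // leq_subr.
Qed.

Lemma histogram_option N (T : finType) (t : T) (s : seq (option T)) :
  size s = N ->
  histogram N.+1 (Some t :: s) =
  add_bot (inord (size (pmap id s)), histogram N.+1 (t :: pmap id s)).
Proof.
move=> sN; have le_pmap : (size (pmap id s) <= N)%N.
  by rewrite size_pmap -sN count_size.
apply/ffunP => -[u|]; rewrite !ffunE; congr inord => /=.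
  by congr addn; elim: s {sN le_pmap} => [|[v|] s IH] //=; rewrite IH.
rewrite inordK // size_pmap -sN -(count_predC isSome s) addKn.
by apply: eq_count => -[].
Qed.

(** Condition on the number N - M of bottoms among the N samples from w: this has weight ['C(N, M)]
    times beta^(N - M), and the other M samples are weighted by c, exactly as in [blanket_law]. *)
Lemma push_add_bot N (T : finType) (p c : T -> R) beta (w0 w : option T -> R) :
  w0 None = 0 -> w0 \o Some =1 p -> w None = beta -> w \o Some = c ->
  push (det_kernel (@add_bot N T)) (blanket_law p c beta) =1
  histogram_law w0 w N.
Proof.
move=> w0N w0S wN wS H; rewrite histogram_lawE /= (bigD1 None) //= w0N mul0r add0r.
rewrite (reindex_omap Some id) => [|[]] //=.
under [RHS]eq_bigl do rewrite eqxx.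
pose k M h := det_kernel (R := R) (@add_bot N T) (M, h).
transitivity (\sum_(M < N.+1) 'C(N, M)%:R * beta ^+ (N - M) *
    indep_sum (p :: nseq M c) (fun s => k M (histogram N.+1 s) H)).
  rewrite /push (eq_bigr (fun o => blanket_law p c beta (o.1, o.2) * k o.1 o.2 H));
    last by case.
  rewrite -(pair_bigA _ (fun M h => blanket_law p c beta (M, h) * k M h H)).
  apply: eq_bigr => M _; rewrite -push_histogram /push. rewrite mulr_sumr.
  by apply: eq_bigr => h _; rewrite mulrA /blanket_law histogram_lawE.
under [LHS]eq_bigr do rewrite /= mulr_sumr.
rewrite exchange_big /=; apply: eq_bigr => t _.
under [LHS]eq_bigr do rewrite mulrCA.
rewrite -mulr_sumr -w0S; congr (_ * _).
(* The final histogram depends only on the samples that are not bottom, which is the form that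
   [indep_sum_thinning] handles. *)
pose F s := k (inord (size s)) (histogram N.+1 (t :: s)) H.
rewrite -[RHS](eq_indep_sum (F := fun s => F (pmap id s))) => [|s]; last first.
  by rewrite size_nseq => sN; rewrite (histogram_option _ sN).
rewrite indep_sum_thinning wN wS; apply: eq_bigr => M _; congr (_ * _).
by apply: eq_indep_sum => s; rewrite size_nseq /F => ->; rewrite inord_val.
Qed.

End BlanketLaw.

(** * Optimality from equivalence on single samples *)

Section Optimality.
Context {R : realType} {X : Type} {Y : finType}.
Implicit Types (r : X -> Y -> R) (x : X) (D : decomposition R X Y).

Lemma inf_prob_le r x y : local_randomizer r -> inf_prob r y <= r x y.
Proof.
move=> hr; apply: ge_inf; last by exists x.
by exists 0 => _ [x' _ <-]; apply: (hr x').1.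
Qed.

(** The point x makes the set of values nonempty, so that its infimum is a true greatest lower
    bound. *)
Lemma le_inf_prob r x y t : (forall x', t <= r x' y) -> t <= inf_prob r y.
Proof.
by move=> tle; apply: lb_le_inf => [|_ [x' _ <-]//]; exists (r x y); exists x.
Qed.

Lemma inf_prob_ge0 r x y : local_randomizer r -> 0 <= inf_prob r y.
Proof. by move=> hr; apply: (le_inf_prob x) => x'; apply: (hr x').1. Qed.

(** If gamma = 0, the infima are nonnegative with sum 0, hence all zero, and the identity holds for
    any omega. *)
Lemma blanket_distE r x omega : local_randomizer r -> blanket_dist r omega ->
  inf_prob r = fun y => blanket_mass r * omega y.
Proof.
move=> hr [_ homega]; apply/funext => y.
have [g0|gN0] := eqVneq (blanket_mass r) 0; last first.
  by rewrite homega // mulrC divfK.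
rewrite g0 mul0r; apply/eqP; move/eqP: g0; rewrite psumr_eq0 => [|z _].
  by move/allP; apply; rewrite mem_index_enum.
exact: (inf_prob_ge0 x).
Qed.

Lemma P_BE r x0 x1 omega n a : local_randomizer r -> blanket_dist r omega ->
  P_B (n := n) r x0 x1 omega a =
  blanket_law (r (if a then x1 else x0)) (inf_prob r) (1 - blanket_mass r).
Proof.
move=> hr /(blanket_distE x0 hr) infE; apply/funext => -[M h].
rewrite /P_B /blanket_law /binomial_pmf /= infE !histogram_lawE /=.
under [in RHS]eq_bigr do rewrite indep_sum_scale mulrCA.
by rewrite -mulr_sumr mulrA -mulr_natl; congr (_ * _); rewrite mulrA mulrAC.
Qed.

(* No condition asks comp_dist to turn coef_a and coef_b back into r x0 and r x1:
   clone_decomposition contains it. *)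
Definition single_sample_equivalent r x0 x1 D : Prop :=
  exists2 k : Y -> component D -> R, is_kernel k &
  [/\ push k (r x0) =1 @coef_a _ _ _ D, push k (r x1) =1 @coef_b _ _ _ D,
      push k (inf_prob r) =1 @coef_c _ _ _ D &
      push (@comp_dist _ _ _ D) (@coef_c _ _ _ D) =1 inf_prob r].

Lemma single_sample_optimal r x0 x1 D :
  local_randomizer r -> clone_decomposition r x0 x1 D ->
  single_sample_equivalent r x0 x1 D -> optimal_decomposition r x0 x1 D.
Proof.
move=> hr hD [k kk [ka kb kc qc]]; split=> // -[//|N] _ omega homega.
pose f := snd_kernel (A := 'I_N.+1) (hist_kernel (n := N.+1) k).
pose g := snd_kernel (A := 'I_N.+1) (hist_kernel (n := N.+1) (@comp_dist _ _ _ D)).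
have kf : is_kernel f by apply/snd_kernel_is_kernel/hist_kernel_is_kernel.
have kg : is_kernel g.
  by apply/snd_kernel_is_kernel/hist_kernel_is_kernel/(comp_dist_is_dist hD).
(* The kernel k preserves total mass, so the infima and the coefficients c have the same sum. *)
have betaE : 1 - blanket_mass r = coef_beta D.
  rewrite -(coef_c_sum hD) /blanket_mass -(sum_push _ kk).
  by rewrite (eq_bigr _ (fun j _ => kc j)) addrK.
pose coef a j := if a then @coef_b _ _ _ D j else @coef_a _ _ _ D j.
have push_k a : push k (r (if a then x1 else x0)) = coef a.
  by apply/funext => j; case: a; rewrite ?ka ?kb.
have push_q a : push (@comp_dist _ _ _ D) (coef a) = r (if a then x1 else x0).
  by apply/funext => y; case: a; rewrite /push /= -?(decomp_x1 hD) -?(decomp_x0 hD).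
have fE a : push f (P_B r x0 x1 omega a) =
    blanket_law (coef a) (@coef_c _ _ _ D) (coef_beta D).
  apply/funext => o; rewrite P_BE // push_blanket_law betaE push_k.
  by rewrite (funext kc).
have GCE a : @P_GC _ _ _ D N.+1 a =
    push (det_kernel (@add_bot N _))
      (blanket_law (coef a) (@coef_c _ _ _ D) (coef_beta D)).
  apply/funext => H.
  by rewrite (push_add_bot (w0 := A_first a) (w := @A_other _ _ _ D)).
(* To the clone law: apply k to every element, then add the bottoms. Back: remove the bottoms, then
   replace every index by a sample from its component. *)
exists (comp_kernel f (det_kernel (@add_bot N _))).
exists (comp_kernel (det_kernel (@drop_bot N _)) g).
split; [apply: comp_kernel_is_kernel => //; exact: det_kernel_is_kernel..|].
move=> a; split=> o; first by rewrite push_comp fE GCE.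
rewrite push_comp GCE (funext (push_det_cancel _ (@add_botK N _))).
by rewrite push_blanket_law push_q (funext qc) P_BE // betaE.
Qed.

End Optimality.

(** * The primary and the simplified decomposition *)

Section PrimaryAndSimplified.
Context {R : realType} {X : Type} {Y : finType}.
Variables (r : X -> Y -> R) (x0 x1 : X) (dflt : X -> Y -> R).
Hypothesis hr : local_randomizer r.
Hypothesis hdflt : forall x, is_dist (dflt x).

Section LeftOver.
Variables (J : finType) (Q : J -> Y -> R) (c : J -> R).
Hypotheses (kQ : is_kernel Q) (Qc : push Q c =1 inf_prob r).
Let beta := 1 - \sum_j c j.

(** Sum over y: [r x] has mass 1, and [inf_prob r] has the mass of c because Q is a kernel. So beta
    is the total excess of [r x] over the infimum. *)
Let betaE x : beta = \sum_y (r x y - inf_prob r y).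
Proof.
rewrite /beta sumrB (hr x).2 -(sum_push c kQ).
by under [in RHS]eq_bigr do rewrite -Qc.
Qed.

Lemma left_over_beta_ge0 : 0 <= beta.
Proof. by rewrite (betaE x0) sumr_ge0 // => y _; rewrite subr_ge0 inf_prob_le. Qed.

Lemma left_over_of_is_dist x : is_dist (left_over_of r Q c beta dflt x).
Proof.
have [b0|bN0] := eqVneq beta 0.
  by rewrite /left_over_of b0 eqxx; exact: hdflt.
have subE y : r x y - \sum_j c j * Q j y = r x y - inf_prob r y.
  by rewrite -Qc.
rewrite /left_over_of (negPf bN0); split=> [y|].
  by rewrite subE divr_ge0 ?left_over_beta_ge0 // subr_ge0 inf_prob_le.
rewrite -mulr_suml; under eq_bigr do rewrite subE.
by rewrite -betaE divff.
Qed.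

Lemma left_over_of_decomp x y :
  r x y = \sum_j c j * Q j y + beta * left_over_of r Q c beta dflt x y.
Proof.
rewrite /left_over_of; have [b0|bN0] := eqVneq beta 0; last first.
  by rewrite [beta * _]mulrC divfK // subrKC.
(* With beta = 0 the nonnegative excesses sum to 0, so [r x] coincides with the infimum. *)
rewrite b0 mul0r addr0; apply/eqP; rewrite -subr_eq0 -/(push Q c y) Qc.
move: b0; rewrite (betaE x) => /eqP; rewrite psumr_eq0 => [|z _].
  by move/allP; apply; rewrite mem_index_enum.
by rewrite subr_ge0 inf_prob_le.
Qed.

End LeftOver.

Lemma push_det_id (p : Y -> R) : push (det_kernel id) p =1 p.
Proof.
move=> y; rewrite /push; under eq_bigr => z _ do rewrite /det_kernel eq_sym mulrC.
exact: sum_indicator.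
Qed.

Let D1 := primary_decomposition r x0 x1 dflt.

Lemma primary_comp_dist : @comp_dist _ _ _ D1 = det_kernel id.
Proof. by apply/funext => j; apply/funext => y; rewrite /det_kernel eq_sym. Qed.

Lemma primary_single_sample_equivalent : single_sample_equivalent r x0 x1 D1.
Proof.
exists (det_kernel id); first exact: det_kernel_is_kernel.
by rewrite primary_comp_dist; split=> y; rewrite push_det_id.
Qed.

Lemma primary_clone_decomposition : clone_decomposition r x0 x1 D1.
Proof.
have kQ : is_kernel (@comp_dist _ _ _ D1).
  by rewrite primary_comp_dist; exact: det_kernel_is_kernel.
have pushE p : push (@comp_dist _ _ _ D1) p =1 p.
  by rewrite primary_comp_dist; exact: push_det_id.
have Qc := pushE (inf_prob r).
split=> //=.
- by move=> y; apply: (hr x0).1.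
- by move=> y; apply: (hr x1).1.
- by move=> y; exact: (inf_prob_ge0 x0).
- exact: (left_over_beta_ge0 kQ Qc).
- exact: (hr x0).2.
- exact: (hr x1).2.
- exact: subrK.
- exact: (left_over_of_is_dist kQ Qc).
- by move=> y; rewrite [RHS]pushE.
- by move=> y; rewrite [RHS]pushE.
- exact: (left_over_of_decomp kQ Qc).
Qed.

Section Simplified.
Hypothesis inf_gt0 : forall y, 0 < inf_prob r y.

Let D2 := simplified_decomposition r x0 x1 dflt.
Let S (j : component D2) := ratio_class r x0 x1 (ssval j).

Definition class_of (y : Y) : component D2 :=
  SeqSub (map_f (fun y => (r x0 y / inf_prob r y, r x1 y / inf_prob r y))
                (mem_enum predT y)).

Lemma mem_ratio_class y j : (y \in S j) = (class_of y == j).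
Proof.
rewrite inE -val_eqE /=; case: (ssval j) => w0 w1; rewrite xpair_eqE /=.
by have iN0 := lt0r_neq0 (inf_gt0 y); congr andb; apply/eqP/eqP => [->|<-];
  rewrite ?mulfK ?divfK.
Qed.

Lemma simplified_coef_a j : @coef_a _ _ _ D2 j = (ssval j).1 * @coef_c _ _ _ D2 j.
Proof.
by rewrite mulr_sumr; apply: eq_bigr => y; rewrite inE => /andP[/eqP-> _].
Qed.

Lemma simplified_coef_b j : @coef_b _ _ _ D2 j = (ssval j).2 * @coef_c _ _ _ D2 j.
Proof.
by rewrite mulr_sumr; apply: eq_bigr => y; rewrite inE => /andP[_ /eqP->].
Qed.

(** Every index comes from a nonempty class, and on it [r x0] is at least the positive infimum. This
    makes the normalisation of the components legitimate. *)
Lemma simplified_coef_a_gt0 j : 0 < @coef_a _ _ _ D2 j.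
Proof.
have [y yj] : exists y, y \in S j.
  by apply/set0Pn; rewrite -ratiosP //; exact: ssvalP.
rewrite /= (bigD1 y) //= ltr_pwDl ?(lt_le_trans (inf_gt0 y)) ?inf_prob_le //.
by rewrite sumr_ge0 // => z _; apply: (hr x0).1.
Qed.

Lemma simplified_comp_dist_is_kernel : is_kernel (@comp_dist _ _ _ D2).
Proof.
move=> j; split=> [y|] /=.
  by case: ifP => // _; rewrite divr_ge0 ?(hr x0).1 ?(ltW (simplified_coef_a_gt0 j)).
by rewrite -big_mkcond -mulr_suml divff // lt0r_neq0 // simplified_coef_a_gt0.
Qed.

Lemma push_class_of (p : Y -> R) j :
  push (det_kernel class_of) p j = \sum_(y in S j) p y.
Proof.
rewrite big_mkcond; apply: eq_bigr => y _.
by rewrite mem_ratio_class /det_kernel; case: eqP; rewrite ?mulr1 ?mulr0.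
Qed.

Lemma push_simplified_comp_dist (e : component D2 -> R) y :
  push (@comp_dist _ _ _ D2) e y =
  e (class_of y) * (r x0 y / @coef_a _ _ _ D2 (class_of y)).
Proof.
rewrite -(sum_indicator (class_of y)
  (fun j => e j * (r x0 y / @coef_a _ _ _ D2 j))).
apply: eq_bigr => j _ /=; rewrite mem_ratio_class.
by case: eqP; rewrite ?mulr1 ?mul1r ?mulr0 ?mul0r.
Qed.

(** Within a ratio class [r x0], [r x1] and the infimum are proportional, so all three share the
    same conditional distribution, the component of that class. *)
Lemma push_simplified_coefs :
  [/\ push (@comp_dist _ _ _ D2) (@coef_a _ _ _ D2) =1 r x0,
      push (@comp_dist _ _ _ D2) (@coef_b _ _ _ D2) =1 r x1 &
      push (@comp_dist _ _ _ D2) (@coef_c _ _ _ D2) =1 inf_prob r].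
Proof.
have aux y : [/\ (ssval (class_of y)).1 != 0, @coef_c _ _ _ D2 (class_of y) != 0,
    r x0 y = (ssval (class_of y)).1 * inf_prob r y &
    r x1 y = (ssval (class_of y)).2 * inf_prob r y].
  have := lt0r_neq0 (simplified_coef_a_gt0 (class_of y)).
  rewrite simplified_coef_a mulf_eq0 negb_or => /andP[-> ->].
  have : y \in S (class_of y) by rewrite mem_ratio_class.
  by rewrite inE => /andP[/eqP ? /eqP ?].
split=> y; rewrite push_simplified_comp_dist ?simplified_coef_b simplified_coef_a;
  have [w0 c0 e0 e1] := aux y; rewrite ?e1 e0.
- by rewrite mulrC divfK // mulf_neq0.
- by rewrite -mulf_div divff // mul1r -mulrA [X in _ * X]mulrCA divff ?mulr1.
- by rewrite -mulf_div divff // mul1r mulrCA divff ?mulr1.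
Qed.

Lemma simplified_single_sample_equivalent : single_sample_equivalent r x0 x1 D2.
Proof.
exists (det_kernel class_of); first exact: det_kernel_is_kernel.
have [_ _ Qc] := push_simplified_coefs.
by split=> // j; rewrite push_class_of.
Qed.

Lemma simplified_clone_decomposition : clone_decomposition r x0 x1 D2.
Proof.
have kQ := simplified_comp_dist_is_kernel.
have [Qa Qb Qc] := push_simplified_coefs.
split=> //=.
- by move=> j; rewrite sumr_ge0 // => y _; apply: (hr x0).1.
- by move=> j; rewrite sumr_ge0 // => y _; apply: (hr x1).1.
- by move=> j; rewrite sumr_ge0 // => y _; apply/ltW.
- exact: (left_over_beta_ge0 kQ Qc).
- by rewrite -(hr x0).2 -(eq_bigr _ (fun y _ => Qa y)) sum_push.
- by rewrite -(hr x1).2 -(eq_bigr _ (fun y _ => Qb y)) sum_push.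
- exact: subrK.
- exact: (left_over_of_is_dist kQ Qc).
- by move=> y; rewrite -[LHS]Qa.
- by move=> y; rewrite -[LHS]Qb.
- exact: (left_over_of_decomp kQ Qc).
Qed.

End Simplified.
End PrimaryAndSimplified.

(** * Sums and kernels on disjoint unions *)

Section TaggedSums.
Context {R : realType} {I : finType}.

Lemma sum_sigma (T : I -> finType) (F : {i : I & T i} -> R) :
  \sum_u F u = \sum_i \sum_(t : T i) F (Tagged T t).
Proof.
by rewrite (sig_big_dep _ _ (fun i t => F (Tagged T t))); apply: eq_bigr => -[].
Qed.

Lemma untag_Tagged (T : I -> Type) (z : R) i (F : T i -> R) t :
  untag z F (Tagged T t) = F t.
Proof. by rewrite (untagE _ _ (erefl : tag (Tagged T t) = i)). Qed.

Lemma sum_untag (T : I -> finType) i (F : T i -> R) :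
  \sum_u untag 0 F u = \sum_t F t.
Proof.
rewrite sum_sigma (bigD1 i) //= [X in _ + X]big1 ?addr0 => [|j ji].
  by apply: eq_bigr => t _; rewrite untag_Tagged.
by rewrite big1 // => t _; rewrite untag_dflt.
Qed.

Lemma sum_tag_untag (T : I -> finType) (c : I -> R) (F : forall i, T i -> R)
    (u : {i : I & T i}) :
  \sum_i c i * untag 0 (F i) u = c (tag u) * F (tag u) (tagged u).
Proof.
case: u => i t; rewrite (bigD1 i) //= (untag_Tagged 0 (F i)) big1 ?addr0 // => j ji.
by rewrite untag_dflt ?mulr0 // eq_sym.
Qed.

Lemma untag_ge0 (T : I -> Type) i (F : T i -> R) u :
  (forall t, 0 <= F t) -> 0 <= untag 0 F u.
Proof. by move=> F_ge0; rewrite /untag; case: eqP. Qed.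

Definition tag_kernel (S T : I -> finType) (k : forall i, S i -> T i -> R) :
    {i : I & S i} -> {i : I & T i} -> R :=
  fun u => untag 0 (k (tag u) (tagged u)).

Lemma tag_kernel_is_kernel (S T : I -> finType) (k : forall i, S i -> T i -> R) :
  (forall i, is_kernel (k i)) -> is_kernel (tag_kernel k).
Proof.
move=> kk u; split=> [v|]; first by apply: untag_ge0 => t; apply: (kk _ _).1.
by rewrite sum_untag (kk _ _).2.
Qed.

(** A tagged kernel never changes the tag, so the mass at v comes from the block of v alone and its
    weight factors out. *)
Lemma push_tag (S T : I -> finType) (k : forall i, S i -> T i -> R)
    (p : I -> R) (q : forall i, S i -> R) v :
  push (tag_kernel k) (fun u => p (tag u) * q (tag u) (tagged u)) v =
  p (tag v) * push (k (tag v)) (q (tag v)) (tagged v).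
Proof.
rewrite /push sum_sigma -(sum_tag_untag p (fun i => push (k i) (q i))).
apply: eq_bigr => i _ /=.
under eq_bigr do rewrite -mulrA; rewrite -mulr_sumr; congr (_ * _).
rewrite /tag_kernel /= /untag; case: eqP => // _.
by rewrite big1 // => s _; rewrite mulr0.
Qed.

End TaggedSums.

(** * Stability under weighted combinations *)

Section WeightedCombination.
Context {R : realType} {X : Type} {m : nat} {Y : 'I_m -> finType}.
Variables (p : 'I_m -> R) (r : forall i, X -> Y i -> R) (x0 x1 : X).
Arguments r : clear implicits.
Hypothesis hp : is_dist p.
Hypothesis hr : forall i, local_randomizer (r i).

Lemma sum_tag_weight (T : 'I_m -> finType) (F : forall i, T i -> R) :
  \sum_(u : {i : 'I_m & T i}) p (tag u) * F (tag u) (tagged u) =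
  \sum_i p i * \sum_t F i t.
Proof. by rewrite sum_sigma; apply: eq_bigr => i _; rewrite mulr_sumr. Qed.

Lemma sum_weight1 (F : 'I_m -> R) : (forall i, F i = 1) -> \sum_i p i * F i = 1.
Proof. by move=> F1; rewrite -hp.2; apply: eq_bigr => i _; rewrite F1 mulr1. Qed.

Lemma parallel_local_randomizer : local_randomizer (parallel p r).
Proof.
move=> x; split=> [u|]; first by rewrite mulr_ge0 ?hp.1 ?(hr _ x).1.
by rewrite (sum_tag_weight (fun i => r i x)) sum_weight1 // => i; exact: (hr i x).2.
Qed.

Lemma inf_prob_parallel (u : {i : 'I_m & Y i}) :
  inf_prob (parallel p r) u = p (tag u) * inf_prob (r (tag u)) (tagged u).
Proof.
case: u => i y /=; apply/le_anti/andP; split; last first.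
  by apply: (le_inf_prob x0) => x; rewrite ler_wpM2l ?hp.1 ?inf_prob_le.
have infle x := inf_prob_le x (Tagged Y y) parallel_local_randomizer.
(* The upper bound divides by [p i], so a vanishing weight is treated apart; there both sides are
   0. *)
have := hp.1 i; rewrite le0r => /predU1P[p0|p_gt0].
  by rewrite p0 mul0r (le_trans (infle x0)) // /parallel /= p0 mul0r.
rewrite -ler_pdivrMl //; apply: (le_inf_prob x0) => x.
by rewrite ler_pdivrMl //; exact: infle.
Qed.

Variables (D : forall i, decomposition R X (Y i)).
Variable (dflt : X -> {i : 'I_m & Y i} -> R).
Hypothesis hdflt : forall x, is_dist (dflt x).
Let W := weighted_combination p D dflt.

Lemma weighted_single_sample_equivalent :
  (forall i, single_sample_equivalent (r i) x0 x1 (D i)) ->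
  single_sample_equivalent (parallel p r) x0 x1 W.
Proof.
move=> hD; pose k i := sval (cid2 (hD i)).
have kk i : is_kernel (k i) by rewrite /k; case: cid2.
have hk i : [/\ push (k i) (r i x0) =1 @coef_a _ _ _ (D i),
    push (k i) (r i x1) =1 @coef_b _ _ _ (D i),
    push (k i) (inf_prob (r i)) =1 @coef_c _ _ _ (D i) &
    push (@comp_dist _ _ _ (D i)) (@coef_c _ _ _ (D i)) =1 inf_prob (r i)].
  by rewrite /k; case: cid2.
exists (tag_kernel k); first exact: tag_kernel_is_kernel.
split=> u.
- by rewrite (push_tag k p (fun i => r i x0)); have [-> _ _ _] := hk (tag u).
- by rewrite (push_tag k p (fun i => r i x1)); have [_ -> _ _] := hk (tag u).
- rewrite (funext inf_prob_parallel) (push_tag k p (fun i => inf_prob (r i))).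
  by have [_ _ -> _] := hk (tag u).
(* The components of the combination form the tagged kernel of the individual components, so
   [push_tag] applies to them as well. *)
- rewrite inf_prob_parallel.
  rewrite (push_tag (fun i => @comp_dist _ _ _ (D i)) p
    (fun i => @coef_c _ _ _ (D i))).
  by have [_ _ _ ->] := hk (tag u).
Qed.

Lemma weighted_clone_decomposition :
  (forall i, clone_decomposition (r i) x0 x1 (D i)) ->
  clone_decomposition (parallel p r) x0 x1 W.
Proof.
move=> hD.
have pushW (e : forall i, component (D i) -> R) u :
  \sum_(j : component W) p (tag j) * e (tag j) (tagged j) * @comp_dist _ _ _ W j u =
  p (tag u) * \sum_j e (tag u) j * comp_dist j (tagged u).
  exact: (push_tag (fun i => @comp_dist _ _ _ (D i)) p e).
have pb_ge0 i : 0 <= p i * coef_beta (D i).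
  by rewrite mulr_ge0 ?hp.1 ?(coef_beta_ge0 (hD i)).
split=> /=.
- move=> j; split=> [u|].
    by apply: untag_ge0; apply: (comp_dist_is_dist (hD _) _).1.
  by rewrite sum_untag (comp_dist_is_dist (hD _) _).2.
- by move=> j; rewrite mulr_ge0 ?hp.1 ?(coef_a_ge0 (hD _)).
- by move=> j; rewrite mulr_ge0 ?hp.1 ?(coef_b_ge0 (hD _)).
- by move=> j; rewrite mulr_ge0 ?hp.1 ?(coef_c_ge0 (hD _)).
- exact: sumr_ge0.
- rewrite (sum_tag_weight (fun i => @coef_a _ _ _ (D i))) sum_weight1 // => i.
  exact: coef_a_sum (hD i).
- rewrite (sum_tag_weight (fun i => @coef_b _ _ _ (D i))) sum_weight1 // => i.
  exact: coef_b_sum (hD i).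
- rewrite (sum_tag_weight (fun i => @coef_c _ _ _ (D i))) -big_split /=.
  under eq_bigr do rewrite -mulrDr.
  by rewrite sum_weight1 // => i; exact: coef_c_sum (hD i).
- move=> x; case: eqP => [_|/eqP bN0]; first exact: hdflt.
  split=> [u|].
    rewrite divr_ge0 ?sumr_ge0 // => i _; rewrite mulr_ge0 //; apply: untag_ge0.
    exact: (left_over_is_dist (hD i) x).1.
  rewrite -mulr_suml exchange_big /=.
  under eq_bigr => i _ do
    rewrite -mulr_sumr sum_untag (left_over_is_dist (hD i) x).2 mulr1.
  exact: divff.
- by move=> u; rewrite (pushW (fun i => @coef_a _ _ _ (D i))) -(decomp_x0 (hD _)).
- by move=> u; rewrite (pushW (fun i => @coef_b _ _ _ (D i))) -(decomp_x1 (hD _)).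
- move=> x u; rewrite (pushW (fun i => @coef_c _ _ _ (D i))) /parallel.
  rewrite (decomp_x (hD _)) mulrDr; congr (_ + _).
  rewrite mulrA; case: eqP => [b0|/eqP bN0]; last first.
    rewrite mulrCA divff // mulr1.
    by rewrite (sum_tag_untag (fun i => p i * coef_beta (D i))
      (fun i => left_over (D i) x)).
  (* If the merged beta is 0, each nonnegative [p i * coef_beta (D i)] vanishes, so the left-over
     term at the tag of u is 0 for any default. *)
  rewrite b0 mul0r; move/eqP: b0; rewrite psumr_eq0 // => /allP/(_ (tag u)).
  by rewrite mem_index_enum => /(_ isT)/eqP ->; rewrite mul0r.
Qed.

End WeightedCombination.

(** * Optimality for the parallel composition *)

Theorem theorem11 (R : realType) (X : Type) (m : nat) (Y : 'I_m -> finType)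
    (r : forall i : 'I_m, X -> Y i -> R) (p : 'I_m -> R) (x0 x1 : X)
    (dflt_i : forall i : 'I_m, X -> Y i -> R)
    (dflt : X -> {i : 'I_m & Y i} -> R)
    (hr : forall i, local_randomizer (r i))
    (hp : is_dist p)
    (hdflt_i : forall i x, is_dist (dflt_i i x))
    (hdflt : forall x, is_dist (dflt x)) :
  optimal_decomposition (parallel p r) x0 x1
    (weighted_combination p
       (fun i => primary_decomposition (r i) x0 x1 (dflt_i i)) dflt)
  /\
  ((forall i y, 0 < inf_prob (r i) y) ->
   optimal_decomposition (parallel p r) x0 x1
     (weighted_combination p
        (fun i => simplified_decomposition (r i) x0 x1 (dflt_i i)) dflt)).
Proof.
split=> [|inf_gt0]; apply: single_sample_optimal.
- exact: parallel_local_randomizer.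
- by apply: weighted_clone_decomposition => // i; exact: primary_clone_decomposition.
- apply: weighted_single_sample_equivalent => // i.
  exact: primary_single_sample_equivalent.
- exact: parallel_local_randomizer.
- apply: weighted_clone_decomposition => // i.
  exact: simplified_clone_decomposition.
- apply: weighted_single_sample_equivalent => // i.
  exact: simplified_single_sample_equivalent.
Qed.
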